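(* Let $M,N\ge1$ be integers, $P,\sigma^2,\beta_1,\beta_2>0$, and let $\mathbf{a}_1,\mathbf{a}_{2,2}\in\mathbb{C}^N$ and $\mathbf{a}_{2,1}\in\mathbb{C}^M$ have unit-modulus entries. Put $\mathbf{h}_1=\sqrt{\beta_1}\,\mathbf{a}_1$ and $\mathbf{H}_2=\sqrt{\beta_2}\,\mathbf{a}_{2,1}\mathbf{a}_{2,2}^{T}$. Over all diagonal matrices $\mathbf{\Psi}=\mathrm{diag}(\psi_1,\dots,\psi_N)$ with $|\psi_n|=1$ for all $n$, the passive-RIS SNR $\frac{P\|\mathbf{H}_2\mathbf{\Psi}\mathbf{h}_1\|^2}{\sigma^2}$ is maximized by $$\psi_n=\exp\left(\mathsf{j}\left(-\angle[\mathbf{a}_1]_n-\angle[\mathbf{a}_{2,2}]_n\right)\right),\quad n=1,\dots,N,$$ and the maximum value is $$\mathrm{SNR}_{\rm P\text{-}RIS}=\frac{P\beta_1\beta_2N^2M}{\sigma^2}.$$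
   Context: $\mathsf{j}$ is the imaginary unit, $\angle z$ is the argument of $z\in\mathbb{C}$, $[\mathbf{a}]_n$ is the $n$-th entry of $\mathbf{a}$, $(\cdot)^T$ is the transpose and $\|\cdot\|$ is the Euclidean norm. The SNR is that of the received signal $\mathbf{y}=\sqrt{P}\,\mathbf{H}_2\mathbf{\Psi}\mathbf{h}_1 s+\mathbf{n}$, with unit-power symbol $s$ and noise $\mathbf{n}\sim\mathcal{N}_{\mathbb{C}}(\mathbf{0},\sigma^2\mathbf{I}_M)$, under maximum-ratio combining. *)

(* Defs.v *)
From mathcomp Require Import all_boot all_order all_algebra.
From mathcomp Require Import complex.
From mathcomp Require Import reals sequences exp trigo.

Set Implicit Arguments.
Unset Strict Implicit.
Unset Printing Implicit Defensive.

Import Order.TTheory GRing.Theory Num.Theory.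
Local Open Scope ring_scope.
Local Open Scope complex_scope.

(* The principal argument, in ]-pi, pi], with the convention carg 0 = 0. *)
Definition carg (R : realType) (z : R[i]) : R :=
  if z == 0 then 0
  else let t := acos (complex.Re z / Normc.normc z) in
       if 0 <= complex.Im z then t else - t.

Definition cexp (R : realType) (z : R[i]) : R[i] :=
  (expR (complex.Re z))%:C * (cos (complex.Im z) +i* sin (complex.Im z)).

Definition l2norm (R : realType) (m : nat) (v : 'cV[R[i]]_m) : R :=
  Num.sqrt (\sum_(i < m) Normc.normc (v i 0) ^+ 2).

Definition unit_modulus (R : realType) (m n : nat) (A : 'M[R[i]]_(m, n)) : Prop :=
  forall i j, `|A i j| = 1.

(* SNR after maximum-ratio combining of y = sqrt P *: H2 Psi h1 s + n, where
   Psi = diag psi, the symbol s has unit power and each entry of the noise n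
   has variance sigma2. *)
Definition passive_ris_snr (R : realType) (M N : nat) (P sigma2 : R)
    (H2 : 'M[R[i]]_(M, N)) (h1 : 'cV[R[i]]_N) (psi : 'rV[R[i]]_N) : R :=
  P * l2norm (H2 *m diag_mx psi *m h1) ^+ 2 / sigma2.

(* Main.v *)
Require Import Defs.
From mathcomp Require Import all_boot all_order all_algebra.
From mathcomp Require Import complex.
From mathcomp Require Import reals sequences exp trigo.
From mathcomp Require Import ring.

Import Order.TTheory GRing.Theory Num.Theory.
Local Open Scope ring_scope.
Local Open Scope complex_scope.

(* The rank-one channel factors as [H2 Psi h1 = sqrt (beta1 beta2) S a21], where
   [S] is the sum of the [a22_n psi_n a1_n]; hence the SNR is
   [P beta1 beta2 M |S|^2 / sigma2]. The triangle inequality gives [|S| <= N],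
   and the chosen phases make every term of [S] equal to 1. *)

Definition cis {R : realType} (t : R) : R[i] := cos t +i* sin t.

(** Bridge between two moduli: the SNR is built on the real-valued [Normc.normc], while
    [unit_modulus] and the triangle inequality use the norm with values in [R[i]]. *)
Lemma normc_normr {R : realType} (z : R[i]) : `|z| = (Normc.normc z)%:C.
Proof. by rewrite normc_def; case: z. Qed.

Lemma normc_eq1 {R : realType} {z : R[i]} : `|z| = 1 -> Normc.normc z = 1.
Proof. by rewrite normc_normr => /complexI. Qed.

Lemma normr_cis {R : realType} (t : R) : `|cis t| = 1.
Proof. by rewrite normc_normr /= cos2Dsin2 sqrtr1. Qed.

Lemma cisD {R : realType} (s t : R) : cis (s + t) = cis s * cis t.
Proof. by rewrite /cis cosD sinD; apply/eqP; rewrite eq_complex /= eqxx addrC eqxx. Qed.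

Lemma cis0 {R : realType} : cis (0 : R) = 1.
Proof. by rewrite /cis cos0 sin0. Qed.

Lemma cexp_im {R : realType} (t : R) : cexp ('i%C * t%:C) = cis t.
Proof. by rewrite /cexp /cis /= !mul0r !mul1r subr0 add0r expR0 mul1r. Qed.

(** On the unit circle [acos] recovers the real part [x], and [sin (acos x)] is the square root of
    [1 - x ^+ 2], which is the absolute value of the imaginary part; the sign test in [carg]
    restores its sign. *)
Lemma cis_carg {R : realType} {z : R[i]} : `|z| = 1 -> cis (carg z) = z.
Proof.
move=> z1; have := normc_eq1 z1; rewrite /carg.
case: eqP z1 => [->|_ _]; first by rewrite normr0 => /eqP; rewrite eq_sym oner_eq0.
move=> n1; rewrite n1 divr1; case: z n1 => x y /= n1.
have sq1 : x ^+ 2 + y ^+ 2 = 1.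
  by rewrite -[LHS]sqr_sqrtr ?addr_ge0 ?sqr_ge0// n1 expr1n.
(* This is the range in which [acosK] and [sin_acos] apply. *)
have x1 : -1 <= x <= 1.
  rewrite -ler_norml -(@ler_pXn2r _ 2) ?nnegrE// expr1n real_normK ?num_real//.
  by rewrite -sq1 lerDl sqr_ge0.
have y2 : 1 - x ^+ 2 = y ^+ 2 by rewrite -sq1 addrC addKr.
have cx : cos (acos x) = x by rewrite acosK.
case: leP => y0; rewrite /cis ?cosN ?sinN cx sin_acos// y2 sqrtr_sqr.
  by rewrite ger0_norm.
by rewrite ltr0_norm// opprK.
Qed.

Lemma l2normZ_sqr {R : realType} {m : nat} (c : R[i]) (v : 'cV[R[i]]_m) :
  l2norm (c *: v) ^+ 2 = Normc.normc c ^+ 2 * l2norm v ^+ 2.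
Proof.
have ge0 (w : 'cV[R[i]]_m) : 0 <= \sum_(i < m) Normc.normc (w i 0) ^+ 2.
  by apply: sumr_ge0 => i _; exact: sqr_ge0.
rewrite /l2norm !sqr_sqrtr// mulr_sumr; apply: eq_bigr => i _.
by rewrite mxE Normc.normcM exprMn.
Qed.

Lemma l2norm_unit_modulus_sqr {R : realType} {m : nat} (v : 'cV[R[i]]_m) :
  unit_modulus v -> l2norm v ^+ 2 = m%:R.
Proof.
move=> v1; rewrite /l2norm (eq_bigr (fun=> 1)) => [|i _].
  by rewrite sumr_const card_ord sqr_sqrtr.
by rewrite normc_eq1 ?expr1n.
Qed.

Lemma rank_one_channel {R : realType} {M N : nat} (b1 b2 : R[i])
    (a1 a22 : 'cV[R[i]]_N) (a21 : 'cV[R[i]]_M) (psi : 'rV[R[i]]_N) :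
  b2 *: (a21 *m a22^T) *m diag_mx psi *m (b1 *: a1)
    = (b2 * b1 * \sum_n a22 n 0 * psi 0 n * a1 n 0) *: a21.
Proof.
(* Reassociating to the right isolates the 1 by 1 block [a22^T *m (diag_mx psi *m a1)], whose only
   entry is the sum. *)
rewrite -scalemxAr -!scalemxAl scalerA -!mulmxA [b1 * b2]mulrC -scalerA.
congr (_ *: _).
apply/matrixP => i j; rewrite ord1 !mxE big_ord1 !mxE mulrC; congr (_ * _).
by apply: eq_bigr => n _; rewrite mul_diag_mx !mxE mulrA.
Qed.

(** The factor [M%:R] is the squared norm of [a21], and each gain comes from squaring its root. Only
    the sum depends on [psi], so comparing SNRs reduces to comparing the moduli of such sums. *)
Lemma passive_ris_snr_rank_one {R : realType} {M N : nat}
    (P sigma2 beta1 beta2 : R)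
    (a1 a22 : 'cV[R[i]]_N) (a21 : 'cV[R[i]]_M) (psi : 'rV[R[i]]_N) :
  0 <= beta1 -> 0 <= beta2 -> unit_modulus a21 ->
  passive_ris_snr P sigma2 ((Num.sqrt beta2)%:C *: (a21 *m a22^T))
      ((Num.sqrt beta1)%:C *: a1) psi
    = P * beta1 * beta2 * M%:R / sigma2
      * Normc.normc (\sum_n a22 n 0 * psi 0 n * a1 n 0) ^+ 2.
Proof.
move=> b1 b2 a21_unit; rewrite /passive_ris_snr rank_one_channel l2normZ_sqr.
rewrite l2norm_unit_modulus_sqr// !Normc.normcM !exprMn.
have sqr_sqrtC (b : R) : 0 <= b -> Normc.normc (Num.sqrt b)%:C ^+ 2 = b.
  by move=> b0; rewrite /= expr0n addr0 sqrtr_sqr ger0_norm ?sqrtr_ge0// sqr_sqrtr.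
by rewrite !sqr_sqrtC//; ring.
Qed.

Lemma normc_sum_le {R : realType} {N : nat} (z : 'I_N -> R[i]) :
  (forall n, `|z n| = 1) -> Normc.normc (\sum_n z n) <= N%:R.
Proof.
(* The real inequality is moved into [R[i]], where [ler_norm_sum] applies. *)
move=> z1; rewrite -lecR -normc_normr rmorph_nat.
apply: le_trans (ler_norm_sum _ _ _) _.
by rewrite (eq_bigr (fun=> 1)) // sumr_const card_ord.
Qed.

Theorem mainTheorem2 (R : realType) (M N : nat) (P sigma2 beta1 beta2 : R)
    (a1 a22 : 'cV[R[i]]_N) (a21 : 'cV[R[i]]_M)
    (M_ge1 : (1 <= M)%N) (N_ge1 : (1 <= N)%N)
    (P_gt0 : 0 < P) (sigma2_gt0 : 0 < sigma2)
    (beta1_gt0 : 0 < beta1) (beta2_gt0 : 0 < beta2)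
    (a1_unit : unit_modulus a1) (a22_unit : unit_modulus a22)
    (a21_unit : unit_modulus a21) :
  let h1 : 'cV[R[i]]_N := (Num.sqrt beta1)%:C *: a1 in
  let H2 : 'M[R[i]]_(M, N) := (Num.sqrt beta2)%:C *: (a21 *m a22^T) in
  let psi_opt : 'rV[R[i]]_N :=
    \row_(n < N) cexp ('i%C * (- carg (a1 n 0) - carg (a22 n 0))%:C) in
  [/\ unit_modulus psi_opt,
      forall psi : 'rV[R[i]]_N, unit_modulus psi ->
        passive_ris_snr P sigma2 H2 h1 psi
          <= passive_ris_snr P sigma2 H2 h1 psi_opt
    & passive_ris_snr P sigma2 H2 h1 psi_opt
        = P * beta1 * beta2 * N%:R ^+ 2 * M%:R / sigma2].
Proof.
move=> h1 H2 psi_opt.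
have psi_opt_unit : unit_modulus psi_opt.
  by move=> i j; rewrite !mxE cexp_im normr_cis.
have snrE psi := passive_ris_snr_rank_one P sigma2 _ _ a1 a22 a21 psi
  (ltW beta1_gt0) (ltW beta2_gt0) a21_unit.
have opt_sum : \sum_n a22 n 0 * psi_opt 0 n * a1 n 0 = N%:R.
  rewrite (eq_bigr (fun=> 1)) ?sumr_const ?card_ord// => n _.
  (* The occurrence numbers pick the factors outside [carg]; all three factors are then phases, and
     their angles add up to 0. *)
  rewrite mxE cexp_im -{1}(cis_carg (a22_unit n 0)) -{2}(cis_carg (a1_unit n 0)).
  by rewrite -!cisD -[RHS]cis0; congr cis; ring.
have opt_norm : Normc.normc (\sum_n a22 n 0 * psi_opt 0 n * a1 n 0) = N%:R.
  by apply: complexI; rewrite opt_sum -normc_normr normr_nat rmorph_nat.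
split; first exact: psi_opt_unit; last by rewrite snrE opt_norm; ring.
move=> psi psi_unit.
rewrite !snrE opt_norm ler_wpM2l//.
  by rewrite divr_ge0 ?mulr_ge0 ?ler0n// ltW.
(* Squaring is monotone on nonnegative reals, so the bound by [N] on the modulus of the sum
   suffices. *)
rewrite lerXn2r ?nnegrE ?ler0n//; first by rewrite -ler0c -normc_normr.
by apply: normc_sum_le => n; rewrite !normrM a22_unit psi_unit a1_unit !mulr1.
Qed.
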